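(* Let $(R,\mathfrak m)$ be a one-dimensional Cohen-Macaulay local ring having minimal multiplicity. Suppose that $R$ is not a discrete valuation ring. Choose $a\in\mathfrak m$ such that $\mathfrak m^2=a\mathfrak m$, and set $B=\mathfrak m:\mathfrak m$. Then the map $$\mathrm{Tr}(R)\setminus\{R\}\to\mathrm{Tr}(B);\qquad I\mapsto \tfrac{I}{a}$$ is (well-defined and) bijective.
   Context: All rings are commutative. For a ring $R$ and an $R$-module $M$, the trace ideal of $M$ is $\mathrm{tr}_R(M)=\sum_{f\in\operatorname{Hom}_R(M,R)}\operatorname{Im} f$. An ideal $I$ of $R$ is a trace ideal in $R$ if $I=\mathrm{tr}_R(M)$ for some $R$-module $M$ (equivalently, $I=\mathrm{tr}_R(I)$). $\mathrm{Tr}(R)$ is the set of all trace ideals in $R$. $\mathrm{Q}(R)$ is the total ring of fractions of $R$; $\mathfrak m:\mathfrak m=\{\alpha\in\mathrm{Q}(R)\mid\alpha\mathfrak m\subseteq\mathfrak m\}$, a subring of $\mathrm{Q}(R)$ containing $R$, isomorphic to $\operatorname{Hom}_R(\mathfrak m,\mathfrak m)$. $\tfrac{I}{a}=\{x/a\in\mathrm{Q}(R)\mid x\in I\}$. A Cohen-Macaulay local ring $R$ has minimal multiplicity if its multiplicity equals $\operatorname{embdim}R-\dim R+1$; in dimension one this is equivalent to the existence of $a\in\mathfrak m$ with $\mathfrak m^2=a\mathfrak m$ (the residue field need not be infinite), and such an $a$ is a non-zerodivisor. *)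

(* Defs.v *)
From HB Require Import structures.
From mathcomp Require Import all_boot all_order all_algebra.
From mathcomp Require Import all_classical.

Set Implicit Arguments.
Unset Strict Implicit.
Unset Printing Implicit Defensive.

Import Order.TTheory GRing.Theory Num.Theory.
Local Open Scope classical_set_scope.
Local Open Scope ring_scope.

Definition is_greatest (P : nat -> Prop) (n : nat) : Prop :=
  P n /\ forall k, P k -> (k <= n)%N.

Definition is_least (P : nat -> Prop) (n : nat) : Prop :=
  P n /\ forall k, P k -> (n <= k)%N.

(* Unlike MathComp's [idealr], the unit ideal is allowed. *)
Record ideal (R : comNzRingType) := Ideal {
  ideal_set :> set R;
  ideal0 : ideal_set 0;
  idealD : forall x y, ideal_set x -> ideal_set y -> ideal_set (x + y);
  idealM : forall r x, ideal_set x -> ideal_set (r * x) }.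

Section Ideals.
Variable R : comNzRingType.

Definition regular (x : R) : Prop := forall y : R, x * y = 0 -> y = 0.

Definition ideal_gen (s : seq R) : set R :=
  [set x | exists c : nat -> R, x = \sum_(i < size s) c i * s`_i].

Definition ideal_mul (I J : set R) : set R :=
  [set x | exists (n : nat) (u v : 'I_n -> R),
     [/\ forall i, I (u i), forall i, J (v i) & x = \sum_i u i * v i]].

Fixpoint ideal_exp (I : set R) (n : nat) : set R :=
  if n is k.+1 then ideal_mul I (ideal_exp I k) else setT.

Definition prime_ideal (P : set R) : Prop :=
  P <> setT /\ forall x y, P (x * y) -> P x \/ P y.

Definition maximal_ideal (M : set R) : Prop :=
  M <> setT /\ forall J : ideal R, M `<=` J -> J = M :> set R \/ J = setT :> set R.

Definition noetherian : Prop :=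
  forall I : ideal R, exists s : seq R, I = ideal_gen s :> set R.

Definition local_ring (m : ideal R) : Prop :=
  maximal_ideal m /\ forall J : ideal R, maximal_ideal J -> J = m :> set R.

Definition discrete_valuation_ring : Prop :=
  [/\ forall x y : R, x * y = 0 -> x = 0 \/ y = 0,
      forall I : ideal R, exists x, I = ideal_gen [:: x] :> set R
    & exists m : ideal R, local_ring m /\ m <> [set 0] :> set R].

Definition strict_chain (n : nat) (c : 'I_n.+1 -> ideal R) : Prop :=
  forall i j : 'I_n.+1, (i < j)%N -> c i `<` c j.

Definition krull_dim (d : nat) : Prop :=
  is_greatest (fun n => exists c : 'I_n.+1 -> ideal R,
    strict_chain c /\ forall i, prime_ideal (c i)) d.

Definition regular_sequence (s : seq R) : Prop :=
  ideal_gen s <> setT /\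
  forall i x, (i < size s)%N ->
    ideal_gen (take i s) (s`_i * x) -> ideal_gen (take i s) x.

Definition depth (m : ideal R) (d : nat) : Prop :=
  is_greatest (fun n => exists s : seq R,
    [/\ size s = n, forall x, x \in s -> ideal_set m x & regular_sequence s]) d.

Definition cohen_macaulay_local (m : ideal R) : Prop :=
  [/\ noetherian, local_ring m & exists d, krull_dim d /\ depth m d].

(* The length of R/I: its submodules are the J/I for J an ideal containing I. *)
Definition length_quotient (I : set R) (l : nat) : Prop :=
  is_greatest (fun n => exists c : 'I_n.+1 -> ideal R,
    strict_chain c /\ forall i, I `<=` c i) l.

Definition hilbert_samuel_poly (m : ideal R) (P : {poly rat}) : Prop :=
  exists N : nat, forall n : nat, (N <= n)%N ->
    exists l : nat, length_quotient (ideal_exp m n.+1) l /\ P.[n%:R] = l%:R.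

Definition multiplicity (m : ideal R) (e : nat) : Prop :=
  exists (d : nat) (P : {poly rat}),
    [/\ krull_dim d, hilbert_samuel_poly m P, size P = d.+1
      & e%:R = d`!%:R * lead_coef P].

Definition embdim (m : ideal R) (v : nat) : Prop :=
  is_least (fun n => exists s : seq R,
    size s = n /\ m = ideal_gen s :> set R) v.

(* e = v - d + 1, rearranged because subtraction on nat is truncated. *)
Definition minimal_multiplicity (m : ideal R) : Prop :=
  exists d e v : nat,
    [/\ krull_dim d, multiplicity m e, embdim m v & (e + d = v + 1)%N].

Definition trace (M : lmodType R) : set R :=
  [set x | exists (n : nat) (f : 'I_n -> {linear M -> R^o}) (u : 'I_n -> M),
     x = \sum_i f i (u i)].

Definition Tr : set (set R) :=
  [set I | exists M : lmodType R, I = trace M].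

End Ideals.

Arguments discrete_valuation_ring : clear implicits.
Arguments noetherian : clear implicits.
Arguments krull_dim : clear implicits.
Arguments Tr : clear implicits.

Section TotalFractions.
Variables (R : comNzRingType) (Q : comUnitRingType) (iota : {rmorphism R -> Q}).

(* (Q, iota) is a localization of R at its set of non-zerodivisors; this
   determines it up to unique isomorphism. *)
Definition total_ring_of_fractions : Prop :=
  [/\ injective iota,
      forall s, regular s -> iota s \is a GRing.unit
    & forall q, exists x s, regular s /\ q = iota x / iota s].

Definition fractions (I : set R) (a : R) : set Q :=
  [set iota x / iota a | x in I].

Definition colon_set (I : ideal R) : set Q :=
  [set q | forall x, ideal_set I x -> (iota @` I) (q * iota x)].

Definition colon_pred (I : ideal R) : {pred Q} := [pred q | `[< colon_set I q >]].

Lemma colon_subring (I : ideal R) : subring_closed (colon_pred I).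
Proof.
split.
- by apply/asboolP => x Ix; exists x; rewrite ?mul1r.
- move=> p q /asboolP hp /asboolP hq; apply/asboolP => x Ix.
  have [y Iy ey] := hp x Ix; have [z Iz ez] := hq x Ix.
  exists (y + (-1) * z); first by apply: idealD => //; apply: idealM.
  by rewrite mulN1r rmorphB mulrBl ey ez.
- move=> p q /asboolP hp /asboolP hq; apply/asboolP => x Ix.
  have [z Iz ez] := hq x Ix; have [y Iy ey] := hp z Iz.
  by exists y => //; rewrite ey ez mulrA.
Qed.

HB.instance Definition _ (I : ideal R) :=
  GRing.isSubringClosed.Build Q (colon_pred I) (colon_subring I).

(* The ring I : I, as a subring of Q. *)
Record colon (I : ideal R) := Colon {
  colon_val :> Q; colon_valP : colon_val \in colon_pred I }.

HB.instance Definition _ (I : ideal R) := [isSub for @colon_val I].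
HB.instance Definition _ (I : ideal R) := [Choice of colon I by <:].
HB.instance Definition _ (I : ideal R) :=
  [SubChoice_isSubComNzRing of colon I by <:].

End TotalFractions.

(* Main.v *)
Require Import Defs.
From HB Require Import structures.
From mathcomp Require Import all_boot all_order all_algebra.
From mathcomp Require Import all_classical.
From mathcomp Require Import ring.

Set Implicit Arguments.
Unset Strict Implicit.
Unset Printing Implicit Defensive.

Import Order.TTheory GRing.Theory Num.Theory.
Local Open Scope classical_set_scope.
Local Open Scope ring_scope.

(** Why the theorem holds. Since R has depth 1, m contains a regular element, and
    [m ^ 2 = a m] then makes [a] itself regular. For [x] in m the fraction
    [x / a] maps m into [m ^ 2 / a = m], so [m / a = B]: multiplication by [a] is
    an isomorphism of R-modules from B onto m. It is called [scale] below, with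
    inverse [unscale], and the map of the theorem is [unscale] on subsets.

    Trace ideals are handled through a criterion with no module in it ([TrP]):
    an ideal I is a trace ideal if and only if every R-linear map from I to R
    has its image in I. Under it the theorem becomes a transport of linear maps
    along [scale].

    From R to B ([trace_ideal_to_colon]): let I be a trace ideal contained in m.
    Multiplication by an element of B is a linear map from I to m, so it
    preserves I, and [I / a] is an ideal of B. A B-linear map from [I / a] to B
    becomes, after conjugation by [scale], a linear map from I to m, so it
    preserves [I / a].

    From B to R ([trace_ideal_of_colon]): let J be a trace ideal of B, and I the
    ideal [a J]. A linear map from I to m becomes an R-linear map from J to B,
    which is B-linear because elements of B are fractions with regular
    denominators ([base_linear_colon_linear]); so it preserves J. It remains to
    see that no linear map from I to R takes a unit as a value ([map_to_max]).
    If it does, it takes the value 1 at some [x] in I; then [I = x R] with [x]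
    regular, and as I is stable under B this forces [B = R], hence [m = a R]. A
    Noetherian local ring whose maximal ideal is generated by a regular element
    is a discrete valuation ring ([principal_maximal_dvr]), which is excluded.

    Injectivity is clear, [a] being a unit of Q and R a subring of Q. *)

(** * Trace ideals *)

Section IdealFacts.
Variable R : comNzRingType.
Implicit Types (I J : ideal R) (M : lmodType R).

Lemma ideal_sum I n (F : 'I_n -> R) :
  (forall i, ideal_set I (F i)) -> ideal_set I (\sum_i F i).
Proof. by move=> IF; apply: big_ind => // [|x y]; [exact: ideal0 | exact: idealD]. Qed.

Lemma ideal_neqT I : (I : set R) <> setT -> ~ ideal_set I 1.
Proof.
by move=> IT I1; apply: IT; apply/seteqP; split=> // x _; rewrite -[x]mulr1; apply: idealM.
Qed.

Definition principal (x : R) : ideal R.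
Proof.
apply: (@Ideal R [set y | exists r, y = r * x]).
- by exists 0; rewrite mul0r.
- by move=> _ _ [r ->] [s ->]; exists (r + s); rewrite mulrDl.
- by move=> r _ [s ->]; exists (r * s); rewrite mulrA.
Defined.

Lemma ideal_gen1 (x : R) : ideal_gen [:: x] = principal x :> set R.
Proof.
apply/seteqP; split=> [y [c ->]|y [r ->]].
  by exists (c 0%N); rewrite /= big_ord1.
by exists (fun=> r); rewrite /= big_ord1.
Qed.

(** An ideal has to be made a module before it can be the argument of a trace. *)
Section IdealModule.
Variable I : ideal R.

Definition ideal_pred : {pred R^o} := [pred x | `[< ideal_set I x >]].

Lemma ideal_submod_closed : submod_closed ideal_pred.
Proof.
split; first exact/asboolP/ideal0.
move=> r x y /asboolP Ix /asboolP Iy.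
by apply/asboolP/idealD => //; apply: idealM.
Qed.

HB.instance Definition _ :=
  GRing.isSubmodClosed.Build R R^o ideal_pred ideal_submod_closed.

Record ideal_module := IdealModule {
  ideal_module_val : R^o; ideal_module_valP : ideal_module_val \in ideal_pred }.

HB.instance Definition _ := [isSub for ideal_module_val].
HB.instance Definition _ := [Choice of ideal_module by <:].
HB.instance Definition _ := [SubChoice_isSubLmodule of ideal_module by <:].

End IdealModule.

Definition trace_ideal M : ideal R.
Proof.
apply: (@Ideal R (trace M)).
- exists 0%N, (fun=> \0), (fun=> 0); by rewrite big_ord0.
- move=> _ _ [n [f [u ->]]] [k [g [v ->]]].
  exists (n + k)%N,
    (fun i : 'I_(n + k) => match fintype.split i with inl j => f j | inr j => g j end),
    (fun i : 'I_(n + k) => match fintype.split i with inl j => u j | inr j => v j end).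
  rewrite big_split_ord /=; congr (_ + _); apply: eq_bigr => i _.
    by rewrite (unsplitK (inl i)).
  by rewrite (unsplitK (inr i)).
- move=> r _ [n [f [u ->]]]; exists n, f, (fun i => r *: u i).
  by rewrite mulr_sumr; apply: eq_bigr => i _; rewrite linearZ.
Defined.

(** Linear maps from I to R are encoded as functions on R constrained on I only,
    so that the criterion below involves neither a subtype nor a bundled map. *)
Definition linear_on I (h : R -> R) : Prop :=
  forall r x y, ideal_set I x -> ideal_set I y ->
    h (r * x + y) = r * h x + h y.

Lemma linear_on0 I h : linear_on I h -> h 0 = 0.
Proof.
by move=> /(_ (-1) 0 0 (ideal0 I) (ideal0 I)); rewrite mulr0 addr0 mulN1r addNr.
Qed.

Lemma linear_onM I h r x : linear_on I h -> ideal_set I x -> h (r * x) = r * h x.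
Proof.
by move=> hL Ix; rewrite -[r * x]addr0 hL ?(linear_on0 hL) ?addr0 //; apply: ideal0.
Qed.

Lemma linear_on_sum I h n (F : 'I_n -> R) : linear_on I h ->
  (forall i, ideal_set I (F i)) -> h (\sum_i F i) = \sum_i h (F i).
Proof.
move=> hL IF; have h0 := linear_on0 hL.
have [] // : ideal_set I (\sum_i F i) /\ h (\sum_i F i) = \sum_i h (F i).
pose K x y := ideal_set I x /\ h x = y.
apply: (big_ind2 K) => //.
  by split=> //; apply: ideal0.
  move=> x1 x2 y1 y2 [Ix <-] [Iy <-]; split; first exact: idealD.
  by rewrite -[x1]mul1r hL // !mul1r.
Qed.

(** If I is the trace of M and h is linear on I, then composing h with a linear
    form on M gives another linear form on M, so h sends the generators of I
    back into I. Conversely a stable ideal is its own trace: the inclusion is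
    one linear form, and stability says that no other one leaves I. *)
Lemma TrP I : Tr R I <->
  forall h, linear_on I h -> forall x, ideal_set I x -> ideal_set I (h x).
Proof.
split=> [[M defI] h hL x Ix|stab].
  have If (f : {linear M -> R^o}) u : ideal_set I (f u).
    by rewrite defI; exists 1%N, (fun=> f), (fun=> u); rewrite big_ord1.
  move: (Ix); rewrite {1}defI => -[n [f [u ->]]].
  rewrite (linear_on_sum hL) //; apply: ideal_sum => i.
  pose g : M -> R^o := fun v => h (f i v).
  have gL : linear g.
    by move=> r v w; rewrite /g linearP hL.
  pose gM := GRing.isLinear.Build _ _ _ _ g gL.
  pose G : {linear M -> R^o} := HB.pack g gM.
  exact: (If G (u i)).
exists (ideal_module I); apply/seteqP; split.
  move=> x Ix.
  have fL : linear (@ideal_module_val I : ideal_module I -> R^o).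
    by [].
  pose fM := GRing.isLinear.Build _ _ _ _ _ fL.
  pose f : {linear ideal_module I -> R^o} := HB.pack (@ideal_module_val I) fM.
  by exists 1%N, (fun=> f), (fun=> IdealModule (asboolT Ix)); rewrite big_ord1.
move=> _ [n [f [u ->]]]; apply: ideal_sum => i.
(* The form [f i] is extended by 0 outside I to get a function on R. *)
pose h x := if pselect (ideal_set I x) is left Ix
  then f i (IdealModule (asboolT Ix)) else 0.
have hE (v : ideal_module I) : h (ideal_module_val v) = f i v.
  rewrite /h; case: pselect => [Iv|nIv].
    by congr (f i _); apply: val_inj.
  by case: nIv; apply/asboolP; apply: (ideal_module_valP v).
rewrite -hE; apply: stab; last exact/asboolP/(ideal_module_valP (u i)).
move=> r x y Ix Iy.
pose X := IdealModule (asboolT Ix : (x : R^o) \in ideal_pred I).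
pose Y := IdealModule (asboolT Iy : (y : R^o) \in ideal_pred I).
by rewrite -[r * x + y]/(ideal_module_val (r *: X + Y)) -[x]/(ideal_module_val X)
  -[y]/(ideal_module_val Y)
  !hE linearP.
Qed.

End IdealFacts.

(** * Noetherian local rings with a principal maximal ideal *)

Section LocalRings.
Variables (R : comNzRingType) (m : ideal R).
Hypothesis m_local : local_ring m.

Lemma local_ring_proper : ~ ideal_set m 1.
Proof. by apply: ideal_neqT; case: m_local => -[]. Qed.

(** Zorn's lemma gives a maximal ideal above I, which can only be m. *)
Lemma proper_ideal_sub_max (I : ideal R) : ~ ideal_set I 1 -> (I : set R) `<=` m.
Proof.
move=> I1.
(* Zorn's lemma is applied to the sets X whose union with I is a proper ideal,
   rather than to the ideals above I, so that the empty chain has an upper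
   bound as well. *)
pose P (X : set R) := exists2 K : ideal R, K = X `|` I :> set R & ~ ideal_set K 1.
have [F FP Ftot|A [[K KE K1] Amax]] := @Zorn_bigcup R P.
  pose U := (\bigcup_(X in F) X) `|` I.
  have cover x y : U x -> U y -> exists K : ideal R,
      [/\ (K : set R) `<=` U, ideal_set K x, ideal_set K y & ~ ideal_set K 1].
    have inI K X : F X -> K = X `|` I :> set R -> (K : set R) `<=` U.
      by move=> FX -> z [Xz|Iz]; [left; exists X | right].
    move=> [[X FX Xx]|Ix] [[Y FY Yy]|Iy]; last by exists I; split=> // z; right.
    - have [XY|YX] := Ftot X Y FX FY.
        have [K KE K1] := FP Y FY; exists K; split=> //; first exact: inI KE.
          by rewrite KE; left; apply: XY.
        by rewrite KE; left.
      have [K KE K1] := FP X FX; exists K; split=> //; first exact: inI KE.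
        by rewrite KE; left.
      by rewrite KE; left; apply: YX.
    - have [K KE K1] := FP X FX; exists K.
      by split=> //; [exact: inI KE | rewrite KE; left | rewrite KE; right].
    - have [K KE K1] := FP Y FY; exists K.
      by split=> //; [exact: inI KE | rewrite KE; right | rewrite KE; left].
  have U0 : U 0 by right; apply: ideal0.
  have UD x y : U x -> U y -> U (x + y).
    by move=> Ux Uy; have [K [KU Kx Ky _]] := cover x y Ux Uy; apply/KU/idealD.
  have UM r x : U x -> U (r * x).
    by move=> Ux; have [K [KU Kx _ _]] := cover x x Ux Ux; apply/KU/idealM.
  exists (Ideal U0 UD UM) => //= U1.
  by have [K [_ ? _ ]] := cover 1 1 U1 U1; apply.
have Kmax : maximal_ideal K.
  split=> [KT|J KJ]; first by apply: K1; rewrite KT.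
  have [J1|J1] := pselect (ideal_set J 1).
    by right; apply/seteqP; split=> // x _; rewrite -[x]mulr1; apply: idealM.
  left; have PJ : P J.
    exists J => //; apply/seteqP; split=> x; first by left.
    by case=> // Ix; apply: KJ; rewrite KE; right.
  have AJ : A `<=` J by move=> x Ax; apply: KJ; rewrite KE; left.
  apply/seteqP; split=> // x Jx; rewrite KE; left.
  by apply: contrapT => Ax; apply: (Amax J) => //; split=> // /(_ x Jx).
by case: m_local => _ /(_ K Kmax) <-; rewrite KE => x; right.
Qed.

Lemma local_unit (x : R) : ~ ideal_set m x -> exists y, y * x = 1.
Proof.
move=> mx; have [[y e]|p1] := pselect (ideal_set (principal x) 1); first by exists y.
by case: mx; apply: (proper_ideal_sub_max p1); exists 1; rewrite mul1r.
Qed.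

Variable a : R.
Hypotheses (ma : ideal_set m a) (areg : regular a).

Lemma regularXn n (x : R) : a ^+ n * x = 0 -> x = 0.
Proof.
elim: n x => [|n IH] x; first by rewrite expr0 mul1r.
by rewrite exprS -mulrA => /areg/IH.
Qed.

(** The ideal L of the elements y with [a ^ n y] in [x R] for some n is finitely
    generated, so one exponent N serves for all of L. If [x = a ^ (N+1) z], then
    z lies in L, and [a ^ N z = r x = r a ^ (N+1) z]. Cancelling [a ^ N] gives
    [(1 - r a) z = 0], where [1 - r a] is a unit. *)
Lemma regular_krull_intersection (x : R) : noetherian R ->
  (forall n, exists z, x = a ^+ n * z) -> x = 0.
Proof.
move=> Rnoeth xdiv.
pose L := [set y | exists n r, a ^+ n * y = r * x].
have L0 : L 0 by exists 0%N, 0; rewrite mulr0 mul0r.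
have LD y z : L y -> L z -> L (y + z).
  move=> [n [r e]] [k [s f]]; exists (n + k)%N, (a ^+ k * r + a ^+ n * s).
  by rewrite exprD; ring: e f.
have LM r y : L y -> L (r * y).
  by move=> [n [s e]]; exists n, (r * s); rewrite mulrCA e mulrA.
have [s sE] := Rnoeth (Ideal L0 LD LM).
have [N HN] : exists N, forall i, (i < size s)%N -> exists r, a ^+ N * s`_i = r * x.
  have : forall y, y \in s -> L y.
    move=> y ys; rewrite -[L y]/(ideal_set (Ideal L0 LD LM) y) sE.
    have ilt : (index y s < size s)%N by rewrite index_mem.
    exists (fun i => (i == index y s)%:R).
    rewrite (bigD1 (Ordinal ilt)) //= eqxx mul1r nth_index // big1 ?addr0 // => i ine.
    by rewrite -val_eqE /= in ine; rewrite (negPf ine) mul0r.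
  elim: (s) => [|y t IH] Ls; first by exists 0%N.
  have [n [r e]] : L y by apply: Ls; rewrite mem_head.
  have [|k Hk] := IH; first by move=> z zt; apply: Ls; rewrite inE zt orbT.
  exists (n + k)%N => -[|i] /= ilt.
    by exists (a ^+ k * r); rewrite exprD -mulrA mulrCA e mulrA.
  have [q f] := Hk i ilt.
  by exists (a ^+ n * q); rewrite exprD -mulrA f mulrA.
have [z xE] := xdiv N.+1.
have Lz : L z by exists N.+1, 1; rewrite mul1r.
move: Lz; rewrite -[L z]/(ideal_set (Ideal L0 LD LM) z) sE => -[c zE].
have [r Nz] : exists r, a ^+ N * z = r * x.
  rewrite {}zE; apply: (big_ind (fun z => exists r, a ^+ N * z = r * x)).
  - by exists 0; rewrite mulr0 mul0r.
  - by move=> u v [p e] [q f]; exists (p + q); rewrite mulrDr e f mulrDl.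
  - by move=> i _; have [q e] := HN i (ltn_ord i); exists (c i * q); rewrite mulrCA e mulrA.
have z_fix : (1 - r * a) * z = 0.
  apply: (@regularXn N); rewrite xE exprS in Nz.
  by rewrite mulrBl mul1r mulrBr Nz; ring.
have [y yE] : exists y, y * (1 - r * a) = 1.
  apply: local_unit => m1; apply: local_ring_proper.
  by rewrite -(subrK (r * a) 1); apply: idealD => //; apply: idealM.
by rewrite xE -[z]mul1r -yE -mulrA z_fix !mulr0.
Qed.

Hypothesis Rnoeth : noetherian R.
Hypothesis m_principal : (m : set R) `<=` principal a.

(** The exponent of [a] in x is the last n such that [a ^ n] divides x, which
    exists because the powers of [a] have no common nonzero multiple. *)
Lemma uniformizer_factor (x : R) : x <> 0 -> exists n u v, x = a ^+ n * u /\ v * u = 1.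
Proof.
move=> x0.
have /existsNP [n0 Hn0] : ~ forall n, exists z, x = a ^+ n * z.
  by move/(regular_krull_intersection Rnoeth).
pose p n := `[< ~ exists z, x = a ^+ n * z >].
have exp_ : exists n, p n by exists n0; apply/asboolP.
case: (ex_minnP exp_) => -[|n] /asboolP pn nmin.
  by case: pn; exists x; rewrite mul1r.
have [u xE] : exists z, x = a ^+ n * z.
  by apply: contrapT => /asboolP/nmin; rewrite ltnn.
have [mu|/local_unit [v vu]] := pselect (ideal_set m u); last by exists n, u, v.
by case: pn; have [r uE] := m_principal mu; exists r; rewrite xE uE exprSr; ring.
Qed.

(** All three properties follow from the factorization of nonzero elements: an
    ideal is generated by the least power of [a] that it contains. *)
Lemma principal_maximal_dvr : discrete_valuation_ring R.
Proof.
split.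
- move=> x y xy0; have [x0|x0] := pselect (x = 0); [by left | right].
  apply: contrapT => y0.
  have [n [u [u' [xE u'u]]]] := uniformizer_factor x0.
  have [k [w [w' [yE w'w]]]] := uniformizer_factor y0.
  have uw0 : u * w = 0.
    apply: (@regularXn (n + k)); rewrite -xy0 xE yE exprD; ring.
  have /eqP : (1 : R) = 0.
    by rewrite -[1]mulr1 -{1}u'u -w'w mulrACA uw0 mulr0.
  by rewrite oner_eq0.
- move=> I; have [I0|/existsNP [x /not_implyP [Ix x0]]] :=
    pselect (forall x, ideal_set I x -> x = 0).
    exists 0; rewrite ideal_gen1; apply/seteqP; split=> [x /I0 ->|x [r ->]].
      by exists 0; rewrite mul0r.
    by rewrite mulr0; apply: ideal0.
  have powI y : ideal_set I y -> y <> 0 ->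
      exists n r, y = r * a ^+ n /\ ideal_set I (a ^+ n).
    move=> Iy /uniformizer_factor [n [u [v [yE vu]]]].
    exists n, u; rewrite mulrC; split=> //.
    by rewrite -[a ^+ n]mulr1 -vu mulrCA -yE; apply: idealM.
  have exn : exists n, `[< ideal_set I (a ^+ n) >].
    by have [n [r [_ In]]] := powI x Ix x0; exists n; apply/asboolP.
  case: (ex_minnP exn) => n /asboolP In nmin; exists (a ^+ n).
  rewrite ideal_gen1; apply/seteqP; split=> [y Iy|y [r ->]]; last exact: idealM.
  have [->|/(powI y Iy) [k [r [-> /asboolP/nmin nk]]]] := pselect (y = 0).
    by exists 0; rewrite mul0r.
  by exists (r * a ^+ (k - n)); rewrite -mulrA -exprD subnK.
exists m; split=> // m0.
have a0 : a = 0 by move: ma; rewrite m0.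
have /eqP := areg (etrans (mulr1 a) a0).
by rewrite oner_eq0.
Qed.

End LocalRings.

(** * The isomorphism from m : m onto m *)

Section MaximalIdealIso.
Variables (R : comNzRingType) (m : ideal R).
Variables (Q : comUnitRingType) (iota : {rmorphism R -> Q}).
Hypothesis Q_frac : total_ring_of_fractions iota.
Variable a : R.
Hypotheses (ma : ideal_set m a) (areg : regular a).
Hypothesis m2a : forall x y, ideal_set m x -> ideal_set m y ->
  exists2 z, ideal_set m z & x * y = a * z.

Local Notation B := (colon iota m).
Local Notation val := (@colon_val R Q iota m).

Lemma colon_valM (b c : B) : val (b * c) = val b * val c.
Proof. by []. Qed.

Lemma iota_inj : injective iota.
Proof. by case: Q_frac. Qed.

Lemma iota_unit s : regular s -> iota s \is a GRing.unit.
Proof. by case: Q_frac => _ + _; apply. Qed.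

Fact base_subproof r : iota r \in colon_pred iota m.
Proof.
apply/asboolP => x mx; exists (r * x); first exact: idealM.
by rewrite rmorphM.
Qed.
Definition base r : B := Colon (base_subproof r).

Lemma scale_subproof (b : B) :
  {x | ideal_set m x & iota x = val b * iota a}.
Proof. by apply: cid2; have /asboolP := colon_valP b; apply. Qed.
Definition scale (b : B) : R := sval (sig_of_sig2 (scale_subproof b)).

Lemma scale_max b : ideal_set m (scale b).
Proof. by rewrite /scale; case: scale_subproof. Qed.

Lemma iota_scale b : iota (scale b) = val b * iota a.
Proof. by rewrite /scale; case: scale_subproof. Qed.

Lemma scaleD b c : scale (b + c) = scale b + scale c.
Proof. by apply: iota_inj; rewrite rmorphD !iota_scale mulrDl. Qed.

Lemma scaleM r b : scale (base r * b) = r * scale b.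
Proof. by apply: iota_inj; rewrite rmorphM !iota_scale mulrA. Qed.

Lemma scale_inj : injective scale.
Proof.
move=> b c /(congr1 iota); rewrite !iota_scale => /(mulIr (iota_unit areg)).
exact: val_inj.
Qed.

(** This is where [m ^ 2] is used: [x / a] multiplies m into [m ^ 2 / a], which is
    contained in m. *)
Lemma scale_surj x : ideal_set m x -> exists b, scale b = x.
Proof.
move=> mx; have qB : iota x / iota a \in colon_pred iota m.
  apply/asboolP => y my; have [z mz e] := m2a mx my.
  exists z => //; rewrite mulrAC -rmorphM e rmorphM mulrC mulKr //.
  exact: iota_unit.
exists (Colon qB); apply: iota_inj; rewrite iota_scale /=.
by rewrite divrK // iota_unit.
Qed.

Definition unscale (x : R) : B := xget 0 [set b | scale b = x].

Lemma unscaleK x : ideal_set m x -> scale (unscale x) = x.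
Proof. by move=> /scale_surj [b sb]; exact: (@xgetI _ 0 [set b | scale b = x] b sb). Qed.

Lemma scaleK b : unscale (scale b) = b.
Proof. by apply: scale_inj; rewrite unscaleK //; apply: scale_max. Qed.

Lemma unscale_linear r x y : ideal_set m x -> ideal_set m y ->
  unscale (r * x + y) = base r * unscale x + unscale y.
Proof.
move=> mx my; apply: scale_inj; rewrite scaleD scaleM !unscaleK //.
by apply: idealD => //; apply: idealM.
Qed.

Lemma colon_set_fractions (I : set R) (J : set B) :
  I `<=` m -> (forall b, J b <-> I (scale b)) ->
  fractions iota I a = val @` J.
Proof.
move=> Im JI; have aU := iota_unit areg; apply/seteqP; split=> [_ [x Ix <-]|_ [b Jb <-]].
  have [b sb] := scale_surj (Im x Ix); exists b; first by rewrite JI sb.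
  by rewrite -sb iota_scale mulrK.
by exists (scale b); [rewrite -JI | rewrite iota_scale mulrK].
Qed.

Lemma colon_clear_denominator (b : B) :
  exists2 s, iota s \is a GRing.unit & exists r, base s * b = base r.
Proof.
case: Q_frac => _ _ /(_ (val b)) [r [s [/iota_unit sU bE]]].
exists s => //; exists r; apply: val_inj.
by rewrite /= bE mulrC divrK.
Qed.

(** Write an element c of B as [r / s]. The elements [g (c x)] and [c (g x)] agree
    after multiplication by s, which is a unit of Q. *)
Lemma base_linear_colon_linear (J : ideal B) (g : B -> B) :
  (forall r x y, ideal_set J x -> ideal_set J y ->
     g (base r * x + y) = base r * g x + g y) -> linear_on J g.
Proof.
move=> gL; have b1 : base 1 = 1 by apply: val_inj; rewrite /= rmorph1.
have gD x y : ideal_set J x -> ideal_set J y -> g (x + y) = g x + g y.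
  by move=> Jx Jy; have := gL 1 x y Jx Jy; rewrite b1 !mul1r.
have g0 : g 0 = 0.
  by apply: (addIr (g 0)); rewrite -gD ?addr0 ?add0r //; apply: ideal0.
have gM r x : ideal_set J x -> g (base r * x) = base r * g x.
  by move=> Jx; have := gL r x 0 Jx (ideal0 J); rewrite !addr0 g0 addr0.
move=> c x y Jx Jy; rewrite gD //; last exact: idealM.
congr (_ + _); have [s sU [r sc]] := colon_clear_denominator c.
have : base s * g (c * x) = base s * (c * g x).
  by rewrite -gM; [rewrite !mulrA sc gM | apply: idealM].
by move=> /(congr1 val); rewrite !colon_valM => /(mulrI sU) e; apply: val_inj.
Qed.

(** * Correspondence of trace ideals *)

(** For [c] in B, multiplication by [c] is a linear map from m to m, hence from I
    to R, and so preserves the trace ideal I. *)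
Lemma trace_ideal_colon_stable (I : ideal R) : Tr R I -> (I : set R) `<=` m ->
  forall b c, ideal_set I (scale b) -> ideal_set I (scale (c * b)).
Proof.
move=> /TrP Itr Im b c Ib.
rewrite -[b]scaleK; apply: (Itr (fun x => scale (c * unscale x))) => //.
move=> r x y /Im mx /Im my.
by rewrite unscale_linear // mulrDr mulrCA scaleD scaleM.
Qed.

Lemma trace_ideal_to_colon (I : ideal R) : Tr R I -> (I : set R) `<=` m ->
  exists2 J : set B, Tr B J & fractions iota I a = val @` J.
Proof.
move=> ITr Im; have stab := trace_ideal_colon_stable ITr Im.
pose L := [set b | ideal_set I (scale b)].
have L0 : L 0.
  rewrite /L /=; suff -> : scale 0 = 0 by apply: ideal0.
  by apply: iota_inj; rewrite iota_scale rmorph0 mul0r.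
have LD x y : L x -> L y -> L (x + y).
  by rewrite /L /= scaleD; apply: idealD.
pose J := Ideal L0 LD (fun c b => @stab b c).
exists J; last exact: colon_set_fractions.
apply/TrP => g gL b /= Lb; rewrite /L /=.
move/TrP: ITr => /(_ (fun x => scale (g (unscale x)))) H.
rewrite -[b]scaleK; apply: H Lb => r x y Ix Iy.
have [mx my] := (Im x Ix, Im y Iy).
rewrite unscale_linear // gL ?scaleD ?scaleM //.
  by rewrite /= /L /= unscaleK.
by rewrite /= /L /= unscaleK.
Qed.

(** A linear map h with [h x = 1] for some [x] in I satisfies [y = x (h y)] for
    all [y] in I, because [x (h y)] and [y (h x)] are both [h (x y)]. So
    [I = x R], and x is regular. Stability of I under B then gives [B = R] inside
    Q, whence [m = a B = a R] and R is a discrete valuation ring. *)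
Lemma map_to_max (I : ideal R) (h : R -> R) :
  local_ring m -> noetherian R -> ~ discrete_valuation_ring R ->
  (forall b c, ideal_set I (scale b) -> ideal_set I (scale (c * b))) ->
  (I : set R) `<=` m -> linear_on I h ->
  forall x, ideal_set I x -> ideal_set m (h x).
Proof.
move=> m_local Rnoeth Rndvr Istab Im hL x0 Ix0; apply: contrapT.
move=> /(local_unit m_local) [v hx0]; apply: Rndvr.
apply: (principal_maximal_dvr m_local ma areg Rnoeth) => z mz.
pose x := v * x0.
have Ix : ideal_set I x by apply: idealM.
have hx : h x = 1 by rewrite (linear_onM v hL).
have I_gen y : ideal_set I y -> y = x * h y.
  by move=> Iy; rewrite -(linear_onM x hL) // mulrC (linear_onM y hL) // hx mulr1.
have xU : iota x \is a GRing.unit.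
  apply: iota_unit => y xy0.
  by rewrite -[y]mulr1 -hx -(linear_onM y hL) // mulrC xy0 (linear_on0 hL).
have colon_base (c : B) : exists r, val c = iota r.
  exists (h (scale (c * unscale x))); apply: (mulIr xU).
  rewrite -rmorphM [_ * x]mulrC -I_gen; last first.
    by apply: Istab; rewrite unscaleK //; apply: Im.
  by rewrite iota_scale colon_valM -mulrA -iota_scale unscaleK //; apply: Im.
have [c <-] := scale_surj mz; have [r cE] := colon_base c.
by exists r; apply: iota_inj; rewrite iota_scale cE rmorphM.
Qed.

Lemma trace_ideal_of_colon (J : ideal B) :
  local_ring m -> noetherian R -> ~ discrete_valuation_ring R -> Tr B J ->
  exists I : ideal R, [/\ Tr R I, (I : set R) `<=` m & fractions iota I a = val @` J].
Proof.
move=> m_local Rnoeth Rndvr Jtr.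
pose L := [set x | exists2 b, ideal_set J b & scale b = x].
have L0 : L 0.
  exists 0; first exact: ideal0.
  by apply: iota_inj; rewrite iota_scale rmorph0 mul0r.
have LD x y : L x -> L y -> L (x + y).
  by move=> [b Jb <-] [c Jc <-]; exists (b + c); [apply: idealD | apply: scaleD].
have LM r x : L x -> L (r * x).
  by move=> [b Jb <-]; exists (base r * b); [apply: idealM | apply: scaleM].
have LJ b : L (scale b) -> ideal_set J b by move=> [c Jc /scale_inj <-].
have Lm : L `<=` m by move=> _ [b _ <-]; apply: scale_max.
exists (Ideal L0 LD LM); split=> //; last first.
  by apply: colon_set_fractions => // b; split=> [Jb|/LJ //]; exists b.
apply/TrP => h hL.
have hm x : L x -> ideal_set m (h x).
  apply: (@map_to_max (Ideal L0 LD LM)) => //= b c /LJ Jb.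
  by exists (c * b) => //; apply: idealM.
pose g b := unscale (h (scale b)).
have gL : linear_on J g.
  apply: base_linear_colon_linear => r x y Jx Jy.
  have [Lx Ly] : L (scale x) /\ L (scale y) by split; [exists x | exists y].
  by rewrite /g scaleD scaleM hL // unscale_linear //; apply: hm.
move=> _ [b Jb <-]; have Lb : L (scale b) by exists b.
exists (g b); last by rewrite unscaleK //; apply: hm.
by move/TrP: Jtr => /(_ g gL); apply.
Qed.

End MaximalIdealIso.

(** The common value of depth and dimension is 1, since a Krull dimension is
    unique, and a regular sequence of length 1 is a regular element. *)
Lemma depth1_regular (R : comNzRingType) (m : ideal R) :
  cohen_macaulay_local m -> krull_dim R 1 ->
  exists2 x, ideal_set m x & regular x.
Proof.
move=> [_ _ [d [[dP dmax] [[s [sz sm [_ sreg]]] _]]]] [P1 max1].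
have d1 : d = 1%N by apply/eqP; rewrite eqn_leq max1 ?dmax.
case: s sz sm sreg => [|x [|]]; rewrite {}d1 // => _ sm sreg.
exists x => [|y xy0]; first by apply: sm; rewrite mem_head.
have [|c ->] := sreg 0%N y isT; first by exists (fun=> 0); rewrite /= big_ord0.
by rewrite /= big_ord0.
Qed.

Theorem theorem5p1 (R : comNzRingType) (m : ideal R)
    (Q : comUnitRingType) (iota : {rmorphism R -> Q})
    (Q_frac : total_ring_of_fractions iota)
    (R_CM : cohen_macaulay_local m)
    (R_dim1 : krull_dim R 1)
    (R_minmult : minimal_multiplicity m)
    (R_not_DVR : ~ discrete_valuation_ring R)
    (a : R) (ma : ideal_set m a)
    (m2E : ideal_mul m m = [set a * x | x in (m : set R)]) :
  let B : comNzRingType := colon iota m in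
  set_bij (Tr R `\ [set: R])
          [set (@colon_val R Q iota m) @` J | J in Tr B]
          (fun I => fractions iota I a).
Proof.
move=> B; have [Rnoeth m_local _] := R_CM.
have m2a x y : ideal_set m x -> ideal_set m y ->
    exists2 z, ideal_set m z & x * y = a * z.
  move=> mx my; have : ideal_mul m m (x * y).
    by exists 1%N, (fun=> x), (fun=> y); split; rewrite ?big_ord1.
  by rewrite m2E => -[z mz <-]; exists z.
have areg : regular a.
  (* If [a y = 0], then y kills [a m = m ^ 2], which contains the regular
     element [x ^ 2]. *)
  have [x mx xreg] := depth1_regular R_CM R_dim1.
  move=> y ay0; have [z _ xxE] := m2a x x mx mx.
  by apply/xreg/xreg; rewrite mulrA xxE mulrAC ay0 mul0r.
split.
- move=> I [[M IE]]; rewrite {}IE => IT.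
  have /(proper_ideal_sub_max m_local) Im : ~ ideal_set (trace_ideal M) 1.
    exact: ideal_neqT.
  have [|J JTr JE] := trace_ideal_to_colon Q_frac ma areg m2a _ Im; first by exists M.
  by exists J.
- move=> I K _ _ /= IK.
  have aU := iota_unit Q_frac areg.
  have sub (X Y : set R) : fractions iota X a = fractions iota Y a -> X `<=` Y.
    move=> XY x Xx; have : fractions iota X a (iota x / iota a) by exists x.
    by rewrite XY => -[y Yy /(divIr aU)/(iota_inj Q_frac) <-].
  by apply/seteqP; split; apply: sub.
- move=> _ [J [M JE] <-]; rewrite {J}JE.
  have [|I [ITr Im IE]] := @trace_ideal_of_colon _ _ _ _ Q_frac _ ma areg m2a
    (trace_ideal M) m_local Rnoeth R_not_DVR; first by exists M.
  exists I => //; split=> // IT; apply: (local_ring_proper m_local).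
  by apply: Im; rewrite IT.
Qed.
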